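(* Let $p>5$ be a prime, and let $d$ be an integer with $\left(\frac{d}{p}\right)=-1$. Let $m$ be an integer with $\frac{p-1}{2}<m<p-1$ and $m\equiv \frac{p-1}{2}\pmod 2$. Then $$S_m(d,p)\equiv 0\pmod p.$$
   Context: $\left(\frac{\cdot}{p}\right)$ denotes the Legendre symbol. For an odd prime $p$, an integer $d$ and a positive integer $m$, $S_m(d,p)$ denotes the integer $$S_m(d,p)=\det\left[(i^2+dj^2)^m\right]_{1\leqslant i,j\leqslant (p-1)/2}.$$ *)

(* Defs.v *)
From mathcomp Require Import all_boot all_order all_algebra.

Set Implicit Arguments.
Unset Strict Implicit.
Unset Printing Implicit Defensive.

Import GRing.Theory.
Local Open Scope ring_scope.

(* Meaningful when [p] is an odd prime. *)
Definition legendre (a : int) (p : nat) : int :=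
  if (p%:Z %| a)%Z then 0
  else if [exists x : 'I_p, ((x%:Z ^+ 2 == a %[mod p%:Z])%Z)] then 1
  else -1.

(* Ordinals start at 0, whence the shifts [i.+1] and [j.+1]. *)
Definition S_det (m : nat) (d : int) (p : nat) : int :=
  \det (\matrix_(i < p.-1./2, j < p.-1./2)
          ((i.+1%:Z ^+ 2 + d * j.+1%:Z ^+ 2) ^+ m)).

(* Main.v *)
Require Import Defs.
From mathcomp Require Import all_boot all_order all_algebra.
From mathcomp Require Import cyclic finfield zify ring.
Local Open Scope ring_scope.

Import GRing.Theory.

(** Write [p = 2n + 1].  Modulo [p], the matrix has a nonzero row vector in its
    left kernel, namely [(i ^ 2s)_i] with [m + 2s = 3n]; the parity of [m] is
    what makes such an [s] exist.  Put [c = d j ^ 2] for a fixed column [j]; it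
    is a non-residue, so [c ^ n = -1] by Euler's criterion.  The entry of the
    product in column [j] is half the sum of [f x = x ^ 2s * (x ^ 2 + c) ^ m]
    over the whole field, because [f] is even.  The substitution [x -> c / x]
    permutes the field and satisfies
      [f (c / x) = c ^ (m + 2s) * x ^ -2(m + 2s) * f x = c ^ 3n * f x = - f x],
    because [x ^ 6n = 1] for [x <> 0].  So the sum equals its own opposite and
    vanishes ([sum_expX2D_eq0]). *)

(** Reindexing by [x -> c / x] changes the sign of each term.  The convention
    [0^-1 = 0] lets [0] be a fixed point, where [0 < s] makes the term vanish. *)
Lemma sum_expX2D_eq0 (F : finFieldType) (c : F) (m s : nat) :
    2%:R != 0 :> F -> (0 < s)%N -> (#|F|.-1 %| 2 * (m + 2 * s))%N ->
    c ^+ (m + 2 * s) = -1 ->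
  \sum_(x : F) x ^+ (2 * s) * (x ^+ 2 + c) ^+ m = 0.
Proof.
move=> two_neq0 s_gt0 /dvdnP[q Eq] c_pow.
have c_neq0 : c != 0.
  apply: contra_eq_neq c_pow => ->.
  rewrite expr0n addn_eq0 muln_eq0 (gtn_eqF s_gt0) andbF.
  by rewrite eq_sym oppr_eq0 oner_eq0.
have divc_inj : injective (fun x : F => c / x).
  by move=> x y /(mulfI c_neq0) /invr_inj.
set T := \sum_x _.
suff T_opp : T = - T.
  have /eqP : 2%:R * T = 0 by rewrite mulr_natl mulr2n {1}T_opp addNr.
  by rewrite mulf_eq0 (negPf two_neq0) /= => /eqP.
rewrite {1}/T (reindex_inj divc_inj) -sumrN; apply: eq_bigr => x _ /=.
have [->|x_neq0] := eqVneq x 0.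
  by rewrite invr0 mulr0 expr0n muln_eq0 /= (gtn_eqF s_gt0) !mul0r oppr0.
have x_pow : x ^+ (2 * (m + 2 * s)) = 1.
  have x_unit : x ^+ #|F|.-1 = 1.
    apply: (mulfI x_neq0); rewrite -exprS prednK ?expf_card ?mulr1 //.
    by apply/card_gt0P; exists x.
  by rewrite Eq mulnC exprM x_unit expr1n.
have -> : (c / x) ^+ 2 + c = c * (x ^+ 2 + c) / x ^+ 2 by field.
apply: (mulIf (expf_neq0 (2 * (m + 2 * s)) x_neq0)).
rewrite [RHS]mulNr [in RHS]x_pow mulr1 -mulN1r -c_pow.
rewrite !(exprMn, exprVn, exprD, mulnDr, exprM).
by field; rewrite !expf_neq0.
Qed.

(** Half of Euler's criterion: [y ^ n] is a square root of [1].  If it were [1],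
    then, writing [y = z ^ k] for a primitive root [z], the order [2n] of [z]
    would divide [k * n]; so [k] would be even and [y] a square. *)
Lemma expf_half_nonsquare (F : finFieldType) (n : nat) (y : F) :
    #|F| = (2 * n).+1 -> y != 0 -> (forall x, x ^+ 2 != y) -> y ^+ n = -1.
Proof.
move=> cardF y_neq0 nonsq.
have unit_pow (x : F) : x != 0 -> x ^+ (2 * n) = 1.
  move=> x_neq0; apply: (mulfI x_neq0).
  by rewrite -exprS -cardF expf_card mulr1.
have n_gt0 : (0 < n)%N by have := finNzRing_gt1 F; rewrite cardF; lia.
have /hasP[z _ z_prim] :
    has (2 * n).-primitive_root [seq x <- enum F | x != 0].
  apply: has_prim_root; first by lia.
  - apply/allP=> x; rewrite mem_filter => /andP[x_neq0 _].
    by apply/unity_rootP; exact: unit_pow.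
  - by rewrite filter_uniq ?enum_uniq.
  - have := cardC1 (0 : F); rewrite cardF /= => <-.
    by rewrite cardE enumT !size_filter.
have := unit_pow y y_neq0; rewrite mulnC exprM => /eqP.
rewrite sqrf_eq1 => /orP[/eqP y_pow|/eqP //].
have [k yE] := prim_rootP z_prim (unit_pow y y_neq0).
move: y_pow; rewrite yE -exprM => /eqP.
rewrite -(prim_order_dvd z_prim) dvdn_pmul2r // => /dvdnP[q kE].
by have := nonsq (z ^+ q); rewrite yE kE exprM eqxx.
Qed.

(** The nonzero elements of the field are the [i.+1] and [-i.-1] for [i < n]. *)
Lemma sum_Fp_even (p n : nat) (V : nmodType) (f : 'F_p -> V) :
    prime p -> p = (2 * n).+1 -> (forall x, f (- x) = f x) ->
  \sum_(x : 'F_p) f x = f 0 + (\sum_(i < n) f i.+1%:R) *+ 2.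
Proof.
move=> p_prime pE f_even.
have -> : \sum_(x : 'F_p) f x = \sum_(0 <= k < p) f k%:R.
  transitivity (\sum_(0 <= k < (Zp_trunc (pdiv p)).+2) f k%:R).
    by rewrite big_mkord; apply: eq_bigr => x _; rewrite natr_Zp.
  by rewrite Fp_cast.
have p0 : p%:R = 0 :> 'F_p by exact: pchar_Fp_0.
rewrite {1}pE big_nat_recl // (@big_cat_nat _ _ _ n) //=; last by lia.
rewrite !big_mkord mulr2n; congr (_ + (_ + _)).
rewrite big_nat_rev /= -{1}[n]addn0 addnC big_addn.
have -> : (2 * n - n = n)%N by lia.
rewrite big_mkord; apply: eq_bigr => i _.
rewrite -f_even; congr f; apply/eqP; rewrite eq_sym -subr_eq0 opprK -natrD.
by apply/eqP; rewrite -[RHS]p0; congr _%:R; have := ltn_ord i; lia.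
Qed.

Lemma legendreN1_nonsquare (p : nat) (d : int) :
    prime p -> legendre d p = -1 ->
  d%:~R != 0 :> 'F_p /\ forall x : 'F_p, x ^+ 2 != d%:~R.
Proof.
move=> p_prime; have p_char := pchar_Fp p_prime; rewrite /legendre.
case: ifPn => // pNd; case: ifPn => // nonsq _.
split=> [|x]; first by rewrite -(dvdz_pcharf p_char).
apply: contra nonsq => /eqP x_sq.
have x_lt : (x < p)%N by rewrite -[X in (_ < X)%N](Fp_cast p_prime) ltn_ord.
apply/existsP; exists (Ordinal x_lt) => /=.
rewrite eqz_mod_dvd (dvdz_pcharf p_char) rmorphB rmorphXn /=.
by rewrite -pmulrn natr_Zp x_sq subrr.
Qed.

Theorem theorem1p1 (p : nat) (d : int) (m : nat)
  (p_prime : prime p) (p_gt5 : (5 < p)%N)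
  (d_nonres : legendre d p = -1)
  (m_range : (p.-1./2 < m < p.-1)%N)
  (m_parity : (m = p.-1./2 %[mod 2])%N) :
  (S_det m d p = 0 %[mod p%:Z])%Z.
Proof.
have p_char := pchar_Fp p_prime.
have [d_neq0 d_nonsq] := legendreN1_nonsquare p d p_prime d_nonres.
have p_odd : odd p by case: (even_prime p_prime) => // p2; rewrite p2 in p_gt5.
rewrite /S_det; set n := p.-1./2 in m_range m_parity *.
have pE : p = (2 * n).+1 by rewrite /n; lia.
have [s sE] : {s | m + 2 * s = 3 * n}%N by exists ((3 * n - m)./2); lia.
have two_neq0 : 2%:R != 0 :> 'F_p.
  by rewrite -(dvdn_pcharf p_char) gtnNdvd //; lia.
have j_neq0 (j : 'I_n) : j.+1%:R != 0 :> 'F_p.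
  by rewrite -(dvdn_pcharf p_char) gtnNdvd //; have := ltn_ord j; lia.
apply/eqP; rewrite eqz_mod_dvd subr0 (dvdz_pcharf p_char) -det_map_mx.
apply/det0P; exists (\row_i i.+1%:R ^+ (2 * s)).
  have n_gt0 : (0 < n)%N by lia.
  apply/eqP=> /rowP/(_ (Ordinal n_gt0)); rewrite !mxE expr1n.
  by move/eqP; rewrite oner_eq0.
apply/rowP=> j; rewrite !mxE.
pose c : 'F_p := d%:~R * j.+1%:R ^+ 2.
have cardF : #|'F_p| = (2 * n).+1 by rewrite card_Fp.
have c_pow : c ^+ n = -1.
  apply: expf_half_nonsquare cardF _ _; first by rewrite mulf_neq0 ?expf_neq0.
  move=> x; apply: contra (d_nonsq (x / j.+1%:R)) => /eqP x_sq.
  by rewrite expr_div_n x_sq mulfK ?expf_neq0.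
pose f (x : 'F_p) := x ^+ (2 * s) * (x ^+ 2 + c) ^+ m.
have f_even x : f (- x) = f x by rewrite /f !exprM sqrrN.
have f_sum : \sum_x f x = 0.
  apply: sum_expX2D_eq0 => //; first by lia.
    by rewrite cardF sE; apply/dvdnP; exists 3; lia.
  by rewrite sE mulnC exprM c_pow; ring.
have f0 : f 0 = 0 by rewrite /f expr0n; case: eqP => [|_]; [lia | rewrite mul0r].
move/eqP: f_sum; rewrite (sum_Fp_even p n) // f0 add0r -mulr_natl mulf_eq0.
rewrite (negPf two_neq0) /= => /eqP f_half; rewrite -[RHS]f_half.
by apply: eq_bigr => i _; rewrite !mxE /f /c rmorphXn rmorphD rmorphM !rmorphXn.
Qed.
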